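(* For $\alpha\in\mathbb{R}$ and $1\le r<2$ let $K_0^{\alpha,r}(t,x)$ be the kernel of the dyadic shift associated to the dilated and translated dyadic grid $\mathcal{D}^{\alpha,r}$. Then the average of these kernels over translations and dilations vanishes: $$\mathbb{E}_r\mathbb{E}_\alpha K_0^{\alpha,r}(t,x):=\frac{1}{\log 2}\int_1^2\lim_{R\to\infty}\frac{1}{2R}\int_{-R}^R K_0^{\alpha,r}(t,x)\,d\alpha\,\frac{dr}{r}=0 .$$
   Context: $\mathcal{D}=\{[m2^{-k},(m+1)2^{-k}):m,k\in\mathbb{Z}\}$ is the standard dyadic grid on $\mathbb{R}$. For $\alpha\in\mathbb{R}$ and $1\le r<2$, $\mathcal{D}^{\alpha,r}=\{rI+\alpha: I\in\mathcal{D}\}$. For an interval $I\in\mathcal{D}^{\alpha,r}$, $I_-$ and $I_+$ are its left and right halves (also elements of $\mathcal{D}^{\alpha,r}$), and $h_I^{\alpha,r}=|I|^{-1/2}(\mathbf{1}_{I_+}-\mathbf{1}_{I_-})$ is the $L^2$-normalized Haar function. The dyadic shift associated with $\mathcal{D}^{\alpha,r}$ is $f\mapsto\sum_{I\in\mathcal{D}^{\alpha,r}}\left[-(f,h^{\alpha,r}_{I_-})h^{\alpha,r}_{I_+}+(f,h^{\alpha,r}_{I_+})h^{\alpha,r}_{I_-}\right]$, with $(f,g)=\int_{\mathbb{R}}fg$, and its kernel is $$K_0^{\alpha,r}(t,x)=\sum_{I\in\mathcal{D}^{\alpha,r}}\left[-h^{\alpha,r}_{I_-}(t)h^{\alpha,r}_{I_+}(x)+h^{\alpha,r}_{I_+}(t)h^{\alpha,r}_{I_-}(x)\right],\qquad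 t,x\in\mathbb{R}.$$ *)

(* Defs.v *)
From HB Require Import structures.
From mathcomp Require Export all_boot all_order all_algebra.
From mathcomp Require Export all_classical all_reals all_analysis.

Set Implicit Arguments.
Unset Strict Implicit.
Unset Printing Implicit Defensive.

Export Order.TTheory GRing.Theory Num.Theory.
Export numFieldNormedType.Exports.

Local Open Scope classical_set_scope.
Local Open Scope ring_scope.

Definition dyadic_grid (R : realType) : set (set R) :=
  [set I | exists m k : int,
     I = `[m%:~R * 2 ^ (- k), (m + 1)%:~R * 2 ^ (- k)[%classic].

Definition dilated_grid (R : realType) (alpha r : R) : set (set R) :=
  [set (fun y => r * y + alpha) @` I | I in @dyadic_grid R].

Definition ilength (R : realType) (I : set R) : R :=
  fine (lebesgue_measure I).

Definition midpoint (R : realType) (I : set R) : R := (inf I + sup I) / 2.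

(* The halves are taken half-open, as the intervals of the grids are. *)
Definition left_half (R : realType) (I : set R) : set R :=
  `[inf I, midpoint I[%classic.

Definition right_half (R : realType) (I : set R) : set R :=
  `[midpoint I, sup I[%classic.

Definition haar (R : realType) (I : set R) (x : R) : R :=
  ilength I `^ (- 2^-1) * (\1_(right_half I) x - \1_(left_half I) x).

Definition shift_kernel_term (R : realType) (t x : R) (I : set R) : R :=
  - haar (left_half I) t * haar (right_half I) x
  + haar (right_half I) t * haar (left_half I) x.

(* [\sum_(I \in D)] is a sum over a possibly infinite set, equal to 0 by
   convention when infinitely many terms are nonzero. *)
Definition shift_kernel (R : realType) (alpha r t x : R) : R :=
  \sum_(I \in dilated_grid alpha r) shift_kernel_term t x I.

Definition translation_mean (R : realType) (r t x T : R) : R :=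
  (2 * T)^-1 *
  \int[@lebesgue_measure R]_(alpha in `[- T, T]) shift_kernel alpha r t x.

Definition translation_average (R : realType) (r t x : R) : R :=
  lim (translation_mean r t x T @[T --> +oo]).

Definition kernel_average (R : realType) (t x : R) : R :=
  (ln 2)^-1 *
  \int[@lebesgue_measure R]_(r in `[1, 2[) (translation_average r t x / r).

(* Main.v *)
Require Import Defs.
From mathcomp Require Import measurable_realfun ring lra zify.

Set Implicit Arguments.
Unset Strict Implicit.
Unset Printing Implicit Defensive.

Local Open Scope classical_set_scope.
Local Open Scope ring_scope.

(** A term of the kernel is nonzero only if the midpoint of its interval
separates [t] from [x], so for each grid at most one term is nonzero.  Group the
terms into layers, one per interval length [s = r 2^j].  With [u = x - t], the
layers with [s <= |u|] vanish, and the others are [O(1/s)], so the kernel is a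
uniform limit of finite sums of layers.  A layer is [s]-periodic in the
translation and its mean is [(2/s) q(u/s)], where [q] ([layer_mean] below) is an
explicit odd piecewise linear function supported in [[-1, 1]].  Its primitive
[Q] ([layer_prim]) vanishes at [0] and outside [[-1, 1]].  In the [dr/r] average
the layers telescope: [u] times the integral of the layer [j] is
[2 (Q(u/2^j) - Q(u/2^(j+1)))], so the whole sum is a multiple of the difference
between the values of [Q] at infinity and at [0], which is zero. *)

(** * The dyadic grid *)

Section profile.
Context {R : realType}.
Implicit Types a s r t x y z w alpha : R.

Definition bump (c y : R) : R := (c <= y < c + 4^-1)%R%:R.

(** Half the kernel term of the interval [0, 1): each bump carries one quarter, and the differences
    are, up to the factor sqrt 2, the Haar functions of the two halves. *)
Definition profile (y z : R) : R :=
  - (bump (1 / 4) y - bump 0 y) * (bump (3 / 4) z - bump (2 / 4) z)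
  + (bump (3 / 4) y - bump (2 / 4) y) * (bump (1 / 4) z - bump 0 z).

Lemma indic_itv (p q y : R) : \1_(`[p, q[%classic) y = (p <= y < q)%R%:R :> R.
Proof. by rewrite indicE mem_setE in_itv. Qed.

Lemma left_half_itv a s : 0 < s ->
  left_half `[a, a + s[ = `[a, a + s / 2[%classic.
Proof.
move=> s0; rewrite /left_half /midpoint inf_itv ?sup_itv ?bnd_simp ?ltrDl//.
by rewrite (_ : (a + (a + s)) / 2 = a + s / 2)//; field.
Qed.

Lemma right_half_itv a s : 0 < s ->
  right_half `[a, a + s[ = `[a + s / 2, a + s / 2 + s / 2[%classic.
Proof.
move=> s0; rewrite /right_half /midpoint inf_itv ?sup_itv ?bnd_simp ?ltrDl//.
rewrite (_ : (a + (a + s)) / 2 = a + s / 2); last by field.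
by rewrite (_ : a + s / 2 + s / 2 = a + s)//; field.
Qed.

Lemma ilength_itv a s : 0 < s -> ilength `[a, a + s[ = s.
Proof.
move=> s0; rewrite /ilength lebesgue_measure_itv/= lte_fin ltrDl s0 -EFinB/=.
by rewrite addrAC subrr add0r.
Qed.

Lemma bump_scale (c a s t : R) : 0 < s ->
  (a + c * s <= t < a + (c + 4^-1) * s)%R%:R = bump c ((t - a) / s) :> R.
Proof.
move=> s0; rewrite /bump; congr (_%:R); congr (nat_of_bool (_ && _)).
  by rewrite ler_pdivlMr// lerBrDl.
by rewrite ltr_pdivrMr// ltrBlDl.
Qed.

Lemma haar_half_norm s : 0 < s ->
  s `^ (- 2^-1) * s `^ (- 2^-1) = s^-1.
Proof.
move=> s0; rewrite -powRD; last by rewrite (gt_eqF s0) implybT.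
by rewrite (_ : - 2^-1 - 2^-1 = -1 :> R) ?powR_inv1 ?ltW//; field.
Qed.

Lemma haar_itvE (c a s t : R) : 0 < s ->
  haar `[a + c * s, a + c * s + s / 2[ t =
  (s / 2) `^ (- 2^-1) * (bump (c + 1 / 4) ((t - a) / s) - bump c ((t - a) / s)).
Proof.
move=> s0; have s20 : 0 < s / 2 by rewrite divr_gt0.
rewrite /haar ilength_itv// right_half_itv// left_half_itv// !indic_itv.
rewrite -!bump_scale//; congr (_ * (_%:R - _%:R)).
  rewrite (_ : a + c * s + s / 2 / 2 = a + (c + 1 / 4) * s); last by field.
  by rewrite (_ : _ + s / 2 / 2 = a + (c + 1 / 4 + 4^-1) * s)//; field.
by rewrite (_ : _ + s / 2 / 2 = a + (c + 4^-1) * s)//; field.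
Qed.

Lemma shift_kernel_term_itv (a s t x : R) : 0 < s ->
  shift_kernel_term t x `[a, a + s[ =
  2 / s * profile ((t - a) / s) ((x - a) / s).
Proof.
move=> s0; rewrite /shift_kernel_term left_half_itv// right_half_itv//.
have h0 y : haar `[a, a + s / 2[ y = haar `[a + 0 * s, a + 0 * s + s / 2[ y.
  by rewrite mul0r addr0.
have h1 y : haar `[a + s / 2, a + s / 2 + s / 2[ y
    = haar `[a + (2 / 4) * s, a + (2 / 4) * s + s / 2[ y.
  by rewrite (_ : a + s / 2 = a + 2 / 4 * s)//; field.
rewrite !{}h0 !{}h1 !haar_itvE//.
rewrite !add0r (_ : 2 / 4 + 1 / 4 = 3 / 4 :> R); last by field.
have /haar_half_norm e : 0 < s / 2 by rewrite divr_gt0.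
rewrite (_ : 2 / s = (s / 2)^-1); last by rewrite invf_div.
by rewrite -e /profile; ring.
Qed.

Lemma bump_bound c y : 0 <= bump c y <= 1.
Proof. by rewrite /bump ler0n lern1 leq_b1. Qed.

Lemma bumpB_bound (c d y : R) : `|bump c y - bump d y| <= 1.
Proof.
have := bump_bound c y; have := bump_bound d y => /andP[? ?] /andP[? ?].
by rewrite ler_norml; apply/andP; split; lra.
Qed.

Lemma bumpB_neq0 (c y : R) : bump (c + 1 / 4) y - bump c y != 0 ->
  c <= y < c + 2^-1.
Proof.
rewrite /bump; case: andP => [[? ?] _|_]; first by apply/andP; split; lra.
case: andP => [[? ?] _|_]; first by apply/andP; split; lra.
by rewrite subrr eqxx.
Qed.

(** Each product pairs a Haar function of the left half with one of the right half; this is the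
    source of the separation of [t] and [x] by a midpoint. *)
Lemma profile_neq0 y z : profile y z != 0 ->
  (0 <= y < 2^-1) && (2^-1 <= z < 1) || (0 <= z < 2^-1) && (2^-1 <= y < 1).
Proof.
have low v : bump (1 / 4) v - bump 0 v != 0 -> 0 <= v < 2^-1.
  by move=> v0; rewrite -[2^-1]add0r; apply: bumpB_neq0; rewrite add0r.
have up v : bump (3 / 4) v - bump (2 / 4) v != 0 -> 2^-1 <= v < 1.
  have := @bumpB_neq0 (2 / 4) v.
  rewrite (_ : 2 / 4 + 1 / 4 = 3 / 4 :> R); last by field.
  by move=> /[apply] /andP[? ?]; apply/andP; split; lra.
rewrite /profile => /eqP yz.
have [/low y0|/negPn/eqP y0] := boolP (bump (1 / 4) y - bump 0 y != 0).
  have [/up z0|/negPn/eqP z0] := boolP (bump (3 / 4) z - bump (2 / 4) z != 0).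
    by rewrite y0 z0.
  have [/up y1|/negPn/eqP y1] := boolP (bump (3 / 4) y - bump (2 / 4) y != 0).
    by lra.
  by case: yz; rewrite y1 z0; ring.
have [/up y1|/negPn/eqP y1] := boolP (bump (3 / 4) y - bump (2 / 4) y != 0).
  have [/low z1|/negPn/eqP z1] := boolP (bump (1 / 4) z - bump 0 z != 0).
    by rewrite y1 z1 orbT.
  by case: yz; rewrite y0 z1; ring.
by case: yz; rewrite y0 y1; ring.
Qed.

Lemma profile_bound y z : `|profile y z| <= 2.
Proof.
rewrite /profile (le_trans (ler_normD _ _))// mulNr normrN.
by rewrite [2](_ : _ = 1 + 1)// lerD// normrM mulr_ile1// bumpB_bound.
Qed.

End profile.

(** * Grid intervals, uniqueness of the nonzero term, and layers *)

Section grid.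
Context {R : realType}.
Implicit Types a s r t x y z w alpha : R.

Definition grid_itv alpha s (m : int) : set R :=
  `[alpha + m%:~R * s, alpha + m%:~R * s + s[.

Definition frac y : R := y - (Num.floor y)%:~R.

(* The sum of the terms over the intervals of length [s]: only the interval
   containing [t] contributes. *)
Definition layer s alpha t x : R :=
  2 / s * profile (frac ((t - alpha) / s)) (frac ((t - alpha) / s) + (x - t) / s).

Lemma affine_itv r alpha (p q : R) : 0 < r ->
  [set r * y + alpha | y in `[p, q[] = `[r * p + alpha, r * q + alpha[%classic.
Proof.
move=> r0; apply/seteqP; split => [_ [y /= + <-]|y /=].
  by rewrite !in_itv/= lerD2r ltrD2r ler_pM2l// ltr_pM2l.
rewrite !in_itv/= => /andP[py yq]; exists ((y - alpha) / r).
  by rewrite /= in_itv/= ler_pdivlMr// ltr_pdivrMr// lerBrDr ltrBlDr ![_ * r]mulrC py.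
by field; rewrite gt_eqF.
Qed.

(** Indexes the grid by the exponent [j] of the length, the opposite of [k] in [dyadic_grid], so
    that the scale grows with [j]. *)
Lemma dilated_gridP alpha r (I : set R) : 0 < r ->
  dilated_grid alpha r I <-> exists j m : int, I = grid_itv alpha (r * 2 ^ j) m.
Proof.
move=> r0; have e (m k : int) :
    [set r * y + alpha | y in `[m%:~R * 2 ^ (- k), (m + 1)%:~R * 2 ^ (- k)[]
    = grid_itv alpha (r * 2 ^ (- k)) m.
  rewrite affine_itv// /grid_itv rmorphD/=.
  rewrite (_ : r * (m%:~R * 2 ^ (- k)) + alpha =
    alpha + m%:~R * (r * 2 ^ (- k))); last by ring.
  rewrite (_ : r * ((m%:~R + 1) * 2 ^ (- k)) + alpha =
    alpha + m%:~R * (r * 2 ^ (- k)) + r * 2 ^ (- k))//; ring.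
split=> [[_ [m [k ->]] <-]|[j [m ->]]]; first by exists (- k), m.
by rewrite -[j]opprK -e; eexists; first by exists m, (- j).
Qed.

Lemma shift_kernel_term_grid alpha s m t x : 0 < s ->
  shift_kernel_term t x (grid_itv alpha s m) =
  2 / s * profile ((t - alpha) / s - m%:~R) ((x - alpha) / s - m%:~R).
Proof.
move=> s0; rewrite /grid_itv shift_kernel_term_itv//.
have e y : (y - (alpha + m%:~R * s)) / s = (y - alpha) / s - m%:~R.
  by field; rewrite gt_eqF.
by rewrite !e.
Qed.

Lemma shift_kernel_term_floor alpha s t x : 0 < s ->
  shift_kernel_term t x (grid_itv alpha s (Num.floor ((t - alpha) / s))) =
  layer s alpha t x.
Proof.
move=> s0; rewrite shift_kernel_term_grid// /layer /frac.
congr (_ * profile _ _); field; exact: lt0r_neq0.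
Qed.

(** After rescaling, both points lie in [0, 1), on different sides of 1/2; [c] is the midpoint of
    the interval. *)
Lemma shift_kernel_term_neq0 alpha s m t x : 0 < s ->
    shift_kernel_term t x (grid_itv alpha s m) != 0 ->
  [/\ Num.floor ((t - alpha) / s) = m, Num.floor ((x - alpha) / s) = m
    & exists2 c, c = alpha + (m%:~R + 2^-1) * s & (t < c <= x) || (x < c <= t)].
Proof.
move=> s0; rewrite shift_kernel_term_grid// mulf_eq0 negb_or => /andP[_].
have e y : (y < alpha + (m%:~R + 2^-1) * s) = ((y - alpha) / s - m%:~R < 2^-1).
  by rewrite ltrBlDl ltr_pdivrMr// ltrBlDl.
have f y : (alpha + (m%:~R + 2^-1) * s <= y) = (2^-1 <= (y - alpha) / s - m%:~R).
  by rewrite lerBrDl ler_pdivlMr// lerBrDl.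
move/profile_neq0 => /orP[/andP[/andP[? ?] /andP[? ?]]|/andP[/andP[? ?] /andP[? ?]]].
  split; [by apply: floor_def; rewrite rmorphD/=; apply/andP; split; lra
         |by apply: floor_def; rewrite rmorphD/=; apply/andP; split; lra|].
  by eexists; [reflexivity|rewrite !e !f; apply/orP; left; apply/andP; split; lra].
split; [by apply: floor_def; rewrite rmorphD/=; apply/andP; split; lra
       |by apply: floor_def; rewrite rmorphD/=; apply/andP; split; lra|].
by eexists; [reflexivity|rewrite !e !f; apply/orP; right; apply/andP; split; lra].
Qed.

(* The midpoint of a dyadic interval is a grid point of every finer scale. *)
Lemma shift_kernel_term_scale_le alpha r (i j m n : int) t x : 0 < r ->
  shift_kernel_term t x (grid_itv alpha (r * 2 ^ i) m) != 0 ->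
  shift_kernel_term t x (grid_itv alpha (r * 2 ^ j) n) != 0 -> (j <= i)%R.
Proof.
move=> r0; have s0 (k : int) : 0 < r * 2 ^ k by rewrite mulr_gt0 ?exprz_gt0.
move=> /(shift_kernel_term_neq0 (s0 i))[ti xi _].
move=> /(shift_kernel_term_neq0 (s0 j))[_ _ [c cE sep]].
rewrite leNgt; apply/negP => ij.
(* If [i < j], then [(n + 1/2) 2^j = (2 n + 1) 2^l 2^i], so [c] is a grid point of scale [i]; yet it
   separates [t] from [x], which share an interval of that scale. *)
have [l lE] : exists l : nat, j = i + l%:Z + 1 by exists (absz (j - i - 1)%R); lia.
have cint : exists M : int, c = alpha + M%:~R * (r * 2 ^ i).
  exists ((2 * n + 1) * 2 ^+ l); rewrite cE lE.
  rewrite !expfzDr// expr1z !rmorphM/= rmorphD/= rmorphM/= rmorphXn/= -exprnP.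
  by field.
case: cint => M cM.
have flt y : y < c -> Num.floor ((y - alpha) / (r * 2 ^ i)) < M.
  by move=> yc; rewrite floor_lt_int ltr_pdivrMr// ltrBlDl -cM.
have fge y : c <= y -> M <= Num.floor ((y - alpha) / (r * 2 ^ i)).
  by move=> cy; rewrite floor_ge_int ler_pdivlMr// lerBrDl -cM.
by case/orP: sep => /andP[/flt + /fge]; rewrite ti xi => A /(lt_le_trans A); rewrite ltxx.
Qed.

(** The comparison of scales applies in both directions, and at a fixed scale the floor of [t]
    determines the interval. *)
Lemma shift_kernel_term_uniq alpha r (I J : set R) t x : 0 < r ->
  dilated_grid alpha r I -> dilated_grid alpha r J ->
  shift_kernel_term t x I != 0 -> shift_kernel_term t x J != 0 -> I = J.
Proof.
move=> r0 /dilated_gridP-/(_ r0)[i [m ->]] /dilated_gridP-/(_ r0)[j [n ->]] Im Jn.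
have ij : i = j.
  apply/eqP; rewrite eq_le (shift_kernel_term_scale_le r0 Jn Im).
  exact: (shift_kernel_term_scale_le r0 Im Jn).
rewrite -{}ij in Jn *; have s0 : 0 < r * 2 ^ i by rewrite mulr_gt0 ?exprz_gt0.
have [<- _ _] := shift_kernel_term_neq0 s0 Im.
by have [<- _ _] := shift_kernel_term_neq0 s0 Jn.
Qed.

Lemma shift_kernel_term_finite alpha r t x : 0 < r ->
  finite_set [set I | dilated_grid alpha r I /\ shift_kernel_term t x I != 0].
Proof.
move=> r0; have [[J [JD J0]]|no] := pselect
    (exists J, dilated_grid alpha r J /\ shift_kernel_term t x J != 0).
  apply: (@sub_finite_set _ _ [set J]); last exact: finite_set1.
  by move=> I [ID I0]; exact: (shift_kernel_term_uniq r0 ID JD I0 J0).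
rewrite (_ : [set _ | _] = set0)//; apply/seteqP; split => // I [ID I0].
by apply: no; exists I.
Qed.

(** A nonzero term equals the layer of its scale, since its interval contains [t]; uniqueness then
    leaves at most one nonzero layer. This replaces the sum over intervals by a sum over scales. *)
Lemma shift_kernel_layer alpha r t x : 0 < r ->
  (shift_kernel alpha r t x = 0 /\ forall j : int, layer (r * 2 ^ j) alpha t x = 0) \/
  (exists2 i : int, shift_kernel alpha r t x = layer (r * 2 ^ i) alpha t x &
     forall j : int, j != i -> layer (r * 2 ^ j) alpha t x = 0).
Proof.
move=> r0; have s0 (k : int) : 0 < r * 2 ^ k by rewrite mulr_gt0 ?exprz_gt0.
have [[i i0]|no] :=
  pselect (exists i : int, layer (r * 2 ^ i) alpha t x != 0); last first.
  left; split => [|j]; last by apply/eqP/negP => /negP j0; apply: no; exists j.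
  rewrite /shift_kernel fsbig1// => I /dilated_gridP-/(_ r0)[j [m ->]].
  apply/eqP/negP => /negP I0; apply: no; exists j.
  have [tm _ _] := shift_kernel_term_neq0 (s0 j) I0.
  by rewrite -shift_kernel_term_floor// tm.
right; exists i.
  rewrite -shift_kernel_term_floor//.
  set I := grid_itv _ _ _.
  have ID : dilated_grid alpha r I by apply/dilated_gridP => //; eexists; eexists.
  rewrite /shift_kernel -(fsbig_widen [set I]) ?fsbig_set1// => [J ->//|J [JD JI]].
  apply/eqP/negP => /negP J0; apply: JI; apply: (shift_kernel_term_uniq r0 JD ID J0).
  by rewrite shift_kernel_term_floor.
move=> j ji; apply/eqP/negP => /negP j0; move/negP: ji; apply; apply/eqP.
rewrite -!shift_kernel_term_floor// in i0 j0.
apply/eqP; rewrite eq_le (shift_kernel_term_scale_le r0 i0 j0).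
exact: (shift_kernel_term_scale_le r0 j0 i0).
Qed.

Lemma layer_bound s alpha t x : 0 < s -> `|layer s alpha t x| <= 4 / s.
Proof.
move=> s0; have s20 : 0 <= 2 / s by rewrite divr_ge0// ltW.
rewrite /layer normrM ger0_norm// (_ : 4 / s = 2 / s * 2); last by ring.
by rewrite ler_wpM2l// profile_bound.
Qed.

(** A nonzero profile puts the two rescaled points in different halves of [0, 1), hence at a
    distance strictly between 0 and 1. *)
Lemma layer_eq0 s alpha t x : 0 < s -> x = t \/ s <= `|x - t| -> layer s alpha t x = 0.
Proof.
move=> s0 H; rewrite /layer; set y := frac _.
have [->|/profile_neq0 p0] := eqVneq (profile y (y + (x - t) / s)) 0.
  by rewrite mulr0.
case: H => [xt|].
  rewrite xt subrr mul0r addr0 in p0.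
  by case/orP: p0 => /andP[/andP[? ?] /andP[? ?]]; exfalso; lra.
rewrite leNgt -[in X in ~~ X](divfK (lt0r_neq0 s0) (x - t)) => /negP[].
rewrite normrM (gtr0_norm s0) -[ltRHS]mul1r ltr_pM2r// ltr_norml.
by case/orP: p0 => /andP[/andP[? ?] /andP[? ?]]; apply/andP; split; lra.
Qed.

End grid.

(** * Approximation of the kernel by finite sums of layers *)

Section approx.
Context {R : realType}.
Implicit Types a s r t x y z w alpha : R.

Lemma ex_exp2_le t x : exists j0 : int, x = t \/ 2 ^ j0 <= `|x - t|.
Proof.
have [->|xt] := eqVneq x t; first by exists 0; left.
have u0 : 0 < `|x - t| by rewrite normr_gt0 subr_eq0.
(* For a natural number [n > 1 / |x - t|], the inequality [n < 2^n] gives [2^(-n) <= |x - t|]. *)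
exists (- (Num.bound `|x - t|^-1)%:Z); right.
rewrite -exprz_inv -exprnP exprVn -[leRHS]invrK lef_pV2 ?posrE ?invr_gt0 ?exprn_gt0//.
have /archi_boundP/ltW b0 : 0 <= `|x - t|^-1 by rewrite invr_ge0 normr_ge0.
by rewrite (le_trans b0)// -natrX ler_nat ltnW// ltn_expl.
Qed.

(** The only possibly nonzero layer [i] vanishes if [i < j0], occurs in the sum if
    [j0 <= i < j0 + N], and otherwise is at most [4 / 2^i]. The bound is uniform in [alpha] and
    [r]. *)
Lemma shift_kernel_approx (j0 : int) N alpha r t x : 1 <= r ->
  x = t \/ r * 2 ^ (j0 - 1) <= `|x - t| ->
  `|shift_kernel alpha r t x - \sum_(n < N) layer (r * 2 ^ (j0 + n%:Z)) alpha t x|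
    <= 4 / 2 ^ (j0 + N%:Z).
Proof.
move=> r1 small; have r0 : 0 < r by rewrite (lt_le_trans _ r1).
have s0 (k : int) : 0 < r * 2 ^ k by rewrite mulr_gt0 ?exprz_gt0.
have e0 : 0 <= 4 / 2 ^ (j0 + N%:Z) :> R by rewrite divr_ge0 ?exprz_ge0.
have [[-> z]|[i -> z]] := shift_kernel_layer alpha t x r0.
  by rewrite big1 ?subrr ?normr0// => n _; rewrite z.
have [ij|ij] := ltP i j0.
  have li : layer (r * 2 ^ i) alpha t x = 0.
    apply: layer_eq0 => //; case: small => [|small]; [by left|right].
    apply: le_trans small; rewrite ler_pM2l// ler_weXz2l ?ler1n//; lia.
  rewrite li big1 ?subrr ?normr0// => n _.
  by have [->|/z] := eqVneq (j0 + n%:Z) i.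
have [m iE] : exists m : nat, i = j0 + m%:Z by exists (absz (i - j0)%R); lia.
have [mN|Nm] := ltnP m N.
  rewrite (bigD1 (Ordinal mN))//= -iE big1 ?addr0 ?subrr ?normr0// => n nm.
  by rewrite z// iE; apply: contra_neq nm => /addrI[] nm; apply/val_inj.
rewrite big1 ?subr0; last first.
  by move=> n _; rewrite z// iE; apply/eqP => /addrI[] nm; have := ltn_ord n; lia.
rewrite (le_trans (layer_bound _ _ _ (s0 i)))//.
rewrite ler_pM2l// lef_pV2 ?posrE ?exprz_gt0//.
rewrite (@le_trans _ _ (2 ^ i))//; last by rewrite ler_peMl// exprz_ge0.
by rewrite iE ler_weXz2l ?ler1n//; lia.
Qed.

End approx.

(** * Averages over translations *)

Section stripes.
Context {R : realType}.
Implicit Types a s r t x y z w alpha : R.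
Local Notation mu := (@lebesgue_measure R).

Lemma measurable_fun_frac : measurable_fun setT (@frac R).
Proof.
apply: measurable_funB => //; apply: nondecreasing_measurable => //.
by move=> y z yz; rewrite ler_int; exact: le_floor.
Qed.

Definition stripes (s t c d : R) : set R :=
  [set alpha | c <= frac ((t - alpha) / s) < d].

Lemma measurable_stripes (s t c d : R) : measurable (stripes s t c d).
Proof.
rewrite (_ : stripes s t c d =
    setT `&` (fun alpha => frac ((t - alpha) / s)) @^-1` `[c, d[); last first.
  by rewrite setTI; apply/seteqP; split => alpha; rewrite /stripes/= in_itv.
suff: measurable_fun setT (fun alpha => frac ((t - alpha) / s)) by exact.
apply: measurableT_comp; first exact: measurable_fun_frac.
by apply: measurable_funM => //; apply: measurable_funB.
Qed.

(** Increasing [alpha] moves the relative position of [t] backwards, so stripes and periods are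
    closed on the right. The maximum with 0 covers empty stripes. *)
Lemma stripes_period (s t c d : R) (m : int) : 0 < s -> 0 <= c -> d <= 1 ->
  mu (stripes s t c d `&` `]t - (m + 1)%:~R * s, t - m%:~R * s]) =
  (s * Num.max 0 (d - c))%:E.
Proof.
move=> s0 c0 d1; rewrite (_ : _ `&` _ =
  `]t - (m%:~R + d) * s, t - (m%:~R + c) * s]%classic); last first.
  have e v alpha : (alpha <= t - (m%:~R + v) * s) = (m%:~R + v <= (t - alpha) / s).
    by rewrite ler_pdivlMr// lerBrDl lerBrDr.
  have f v alpha : (t - (m%:~R + v) * s < alpha) = ((t - alpha) / s < m%:~R + v).
    by rewrite ltr_pdivrMr// ltrBlDr ltrBlDl.
  have fl alpha : m%:~R + 0 <= (t - alpha) / s < m%:~R + 1 ->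
      frac ((t - alpha) / s) = (t - alpha) / s - m%:~R.
    by rewrite addr0 -intrD1 /frac => /floor_def ->.
  apply/seteqP; split => alpha /=; rewrite /stripes/= !in_itv/=.
    rewrite intrD1 -[m%:~R as X in _ && (_ <= t - X * s)]addr0 f e f e.
    by move=> [+ /andP[? ?]]; rewrite fl; lra.
  rewrite intrD1 -[m%:~R as X in _ && (_ <= t - X * s)]addr0 !f !e => /andP[? ?].
  by rewrite fl; lra.
rewrite lebesgue_measure_itv/= lte_fin ltrD2l ltrN2 ltr_pM2r// ltrD2l.
case: ltP => dc.
  by rewrite -EFinB; congr (_%:E); rewrite max_r ?subr_ge0 1?ltW//; ring.
by rewrite max_l ?mulr0// subr_le0.
Qed.

Lemma stripes_periods (s t c d : R) (n : int) (k : nat) : 0 < s -> 0 <= c -> d <= 1 ->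
  mu (stripes s t c d `&` `]t - n%:~R * s, t - n%:~R * s + k%:R * s]) =
  (k%:R * (s * Num.max 0 (d - c)))%:E.
Proof.
move=> s0 c0 d1; elim: k => [|k IH].
  by rewrite !mul0r addr0 set_itvoc0 setI0 measure0.
have ks : t - n%:~R * s <= t - n%:~R * s + k%:R * s.
  by rewrite lerDl mulr_ge0// ltW.
(* The period added on the right has index [n - k - 1], because the index decreases as [alpha]
   grows. *)
have -> : `]t - n%:~R * s, t - n%:~R * s + k.+1%:R * s]%classic =
   `]t - n%:~R * s, t - n%:~R * s + k%:R * s] `|`
   `]t - ((n - k%:Z - 1) + 1)%:~R * s, t - (n - k%:Z - 1)%:~R * s].
  rewrite (_ : t - ((n - k%:Z - 1) + 1)%:~R * s = t - n%:~R * s + k%:R * s); last first.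
    by rewrite subrK rmorphB/=; ring.
  rewrite (_ : t - (n - k%:Z - 1)%:~R * s = t - n%:~R * s + k.+1%:R * s); last first.
    by rewrite !rmorphB/= -natr1; ring.
  by rewrite -itv_bndbnd_setU// bnd_simp// lerD2l ler_pM2r// ler_nat.
rewrite setIUr measureU.
- rewrite -natr1 mulrDl mul1r EFinD.
  by congr (_ + _)%E; [exact: IH|exact: stripes_period].
- by apply: measurableI => //; exact: measurable_stripes.
- by apply: measurableI => //; exact: measurable_stripes.
- apply/seteqP; split => // alpha [[_ +] [_]] /=.
  rewrite !in_itv/= => /andP[_ A] /andP[B _].
  have := lt_le_trans B A; rewrite subrK rmorphB/=.
  by rewrite (_ : t - _ = t - n%:~R * s + k%:R * s) ?ltxx//; ring.
Qed.

(** The window is squeezed between unions of whole periods centred at [t]; rounding and off-centring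
    cost at most [|t| + s] on each side. *)
Lemma stripes_mean_bound (s t c d T : R) : 0 < s -> 0 <= c -> d <= 1 -> 0 < T ->
  `| fine (mu (stripes s t c d `&` `[- T, T])) - 2 * T * Num.max 0 (d - c)|
  <= 2 * (`|t| + s) * Num.max 0 (d - c).
Proof.
move=> s0 c0 d1 T0; set p := Num.max _ _; set E := stripes _ _ _ _.
have p0 : 0 <= p by rewrite le_max lexx.
have mE : measurable E by exact: measurable_stripes.
have fin (a b : R) : mu (E `&` `[a, b]) \is a fin_num.
  rewrite ge0_fin_numE// (@le_lt_trans _ _ (mu `[a, b]))//.
    by apply: le_measure => //; rewrite inE//; apply: measurableI.
  by rewrite lebesgue_measure_itv/=; case: ifP => _; rewrite ?ltry// -EFinB ltry.
have tl : - `|t| <= t by rewrite lerNl -normrN ler_norm.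
have tu := ler_norm t.
have sym (n : nat) : `]t - n%:R * s, t - n%:R * s + (n + n)%:R * s]%classic
    = `]t - n%:R * s, t + n%:R * s]%classic.
  by rewrite (_ : _ + (n + n)%:R * s = t + n%:R * s)// natrD; ring.
have muE (n : nat) : mu (E `&` `]t - n%:R * s, t + n%:R * s]) =
    ((n + n)%:R * (s * p))%:E.
  by rewrite -sym; exact: (stripes_periods t n%:Z (n + n) s0 c0 d1).
pose J (n : nat) := `]t - n%:R * s, t + n%:R * s]%classic.
pose K := `[- T, T]%classic.
rewrite ler_norml; apply/andP; split.
  (* For [|t| > T] nonnegativity of the measure is enough; otherwise [n] whole periods on either
     side of [t] fit into the window. *)
  have [tT|Tt] := leP `|t| T; last first.
    have : 0 <= fine (mu (E `&` `[- T, T])) by rewrite fine_ge0.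
    have : 0 <= (`|t| - T) * p by rewrite mulr_ge0// subr_ge0 ltW.
    have : 0 <= s * p by rewrite mulr_ge0// ltW.
    lra.
  have /truncn_itv : 0 <= (T - `|t|) / s by rewrite divr_ge0 ?subr_ge0// ltW.
  set n := Num.trunc _; rewrite ler_pdivlMr// ltr_pdivrMr// -natr1 => /andP[n1 n2].
  have : (mu (E `&` J n) <= mu (E `&` K))%E.
    apply: le_measure; rewrite ?inE /J /K; [exact: measurableI|exact: measurableI|].
    apply: setIS => alpha; rewrite /J /K /= !in_itv/= => /andP[? ?].
    by apply/andP; split; lra.
  rewrite [mu (E `&` J _)]muE -(fineK (fin _ _)) lee_fin natrD => H.
  have : 0 <= (n%:R * s + s - (T - `|t|)) * p by rewrite mulr_ge0//; lra.
  lra.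
(* Here [n.+1] periods on either side of [t] cover the window. *)
have /truncn_itv : 0 <= (T + `|t|) / s by rewrite divr_ge0 ?addr_ge0// ltW.
set n := Num.trunc _; rewrite ler_pdivlMr// ltr_pdivrMr// -natr1 => /andP[n1 n2].
have : (mu (E `&` K) <= mu (E `&` J n.+1))%E.
  apply: le_measure; rewrite ?inE /J /K; [exact: measurableI|exact: measurableI|].
  apply: setIS => alpha; rewrite /J /K /= !in_itv/= -natr1 => /andP[? ?].
  by apply/andP; split; lra.
rewrite [mu (E `&` J _)]muE -(fineK (fin _ _)) lee_fin natrD -natr1 => H.
have : 0 <= (T + `|t| - n%:R * s) * p by rewrite mulr_ge0//; lra.
lra.
Qed.

End stripes.

(** * Means over translations, up to the mean of a layer *)

Section mean.
Context {R : realType}.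
Implicit Types a s r t x y z w alpha : R.
Local Notation mu := (@lebesgue_measure R).

Definition mean (f : R -> R) (T : R) : R :=
  (2 * T)^-1 * \int[mu]_(alpha in `[- T, T]) f alpha.

(** Measurability and boundedness are bundled with the limit because they make [f] integrable on
    every window, as linearity of the integral requires. *)
Definition has_mean (f : R -> R) (l : R) :=
  [/\ measurable_fun setT f, exists M, forall alpha, `|f alpha| <= M
    & mean f T @[T --> +oo] --> l].

Lemma bounded_itv_integrable (f : R -> R) (i : interval R) (M : R) :
  (mu [set` i] < +oo)%E -> measurable_fun [set` i] f ->
  {in i, forall y, `|f y| <= M} -> mu.-integrable [set` i] (EFin \o f).
Proof.
move=> ifin mf fM; apply: measurable_bounded_integrable => //.
exists M; split; first exact: num_real.
by move=> N MN y /= yi; rewrite (le_trans (fM _ yi))// ltW.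
Qed.

Lemma mean_integrable (f : R -> R) (M T : R) : measurable_fun setT f ->
  (forall alpha, `|f alpha| <= M) -> mu.-integrable `[- T, T] (EFin \o f).
Proof.
move=> mf fM; apply: (@bounded_itv_integrable _ _ M) => //.
  by rewrite lebesgue_measure_itv/=; case: ifP => _; rewrite ?ltry// -EFinB ltry.
exact: measurable_funTS.
Qed.

Lemma has_meanD f g l m : has_mean f l -> has_mean g m -> has_mean (f \+ g) (l + m).
Proof.
move=> [mf [M fM] fl] [mg [N gN] gm]; split; first exact: measurable_funD.
  by exists (M + N) => alpha; rewrite (le_trans (ler_normD _ _))// lerD.
rewrite (_ : mean _ = fun T => mean f T + mean g T); first exact: cvgD.
apply/funext => T; rewrite /mean RintegralD ?mulrDr//; exact: mean_integrable.
Qed.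

Lemma has_meanZ k f l : has_mean f l -> has_mean (fun alpha => k * f alpha) (k * l).
Proof.
move=> [mf [M fM] fl]; split; first exact: measurable_funM.
  by exists (`|k| * M) => alpha; rewrite normrM ler_wpM2l.
rewrite (_ : mean _ = fun T => k * mean f T); first exact: cvgMr.
apply/funext => T; rewrite /mean RintegralZl 1?mulrCA//; exact: mean_integrable.
Qed.

Lemma has_mean0 : has_mean (fun=> 0) 0.
Proof.
split => //; first by exists 0 => _; rewrite normr0.
rewrite (_ : mean _ = cst 0); first exact: cvg_cst.
by apply/funext => T; rewrite /mean Rintegral_cst// mul0r mulr0.
Qed.

Lemma has_mean_sum N (f : 'I_N -> R -> R) (l : 'I_N -> R) :
  (forall n, has_mean (f n) (l n)) ->
  has_mean (fun alpha => \sum_(n < N) f n alpha) (\sum_(n < N) l n).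
Proof.
elim: N f l => [|N IH] f l fl.
  by rewrite big_ord0; under eq_fun do rewrite big_ord0; exact: has_mean0.
rewrite big_ord_recr/=; under eq_fun do rewrite big_ord_recr/=.
by apply: has_meanD => //; exact: IH.
Qed.

Lemma has_mean_stripes (s t c d : R) : 0 < s -> 0 <= c -> d <= 1 ->
  has_mean (\1_(stripes s t c d)) (Num.max 0 (d - c)).
Proof.
move=> s0 c0 d1; set p := Num.max _ _; split.
- by apply: measurable_indic; exact: measurable_stripes.
- by exists 1 => alpha; rewrite indicE ger0_norm// lern1 leq_b1.
have bound T : 0 < T -> `|mean (\1_(stripes s t c d)) T - p| <= (`|t| + s) * p * T^-1.
  move=> T0; rewrite /mean /Rintegral integral_indic//; last exact: measurable_stripes.
  have := stripes_mean_bound t s0 c0 d1 T0; set J := fine _ => JT.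
  rewrite (_ : _ - _ = (2 * T)^-1 * (J - 2 * T * p)); last first.
    by rewrite mulrBr mulKf// mulf_neq0// gt_eqF.
  have T2 : 0 < 2 * T by rewrite mulr_gt0.
  rewrite normrM gtr0_norm ?invr_gt0// ler_pdivrMl// (le_trans JT)//.
  rewrite le_eqVlt; apply/orP; left; apply/eqP.
  by rewrite -/p; field; rewrite gt_eqF.
apply/cvgrPdist_le => e e0.
have K0 : 0 <= (`|t| + s) * p by rewrite mulr_ge0 ?addr_ge0 ?le_max ?lexx// ltW.
near=> T; have T0 : 0 < T by near: T; exact: nbhs_pinfty_gt.
rewrite distrC (le_trans (bound _ T0))// ler_pdivrMr//.
by rewrite -ler_pdivrMl//; near: T; exact: nbhs_pinfty_ge.
Unshelve. all: end_near. Qed.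

(* The correlation of two intervals of length 1/4 at offset [w]. *)
Definition tri w : R := Num.max 0 (4^-1 - `|w|).

(** The product is the indicator of one stripe, the intersection of the quarter intervals starting
    at [a] and at [b - w]. The bounds on [a] keep the stripe inside [0, 1]. *)
Lemma has_mean_bump (a b w s t : R) : 0 < s -> 0 <= a -> a <= 3 / 4 ->
  has_mean (fun alpha => bump a (frac ((t - alpha) / s)) *
                         bump b (frac ((t - alpha) / s) + w)) (tri (w + (a - b))).
Proof.
move=> s0 a0 a34; pose c := Num.max a (b - w); pose d := Num.min a (b - w) + 4^-1.
rewrite (_ : (fun _ => _) = \1_(stripes s t c d)); last first.
  apply/funext => alpha; rewrite indicE.
  rewrite (_ : (_ \in _) = (c <= frac ((t - alpha) / s) < d)); last first.
    by apply/idP/idP; rewrite inE.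
  rewrite /bump -natrM mulnb; congr (_%:R); congr nat_of_bool.
  set y := frac _; rewrite /c /d ge_max minElt lerBlDr.
  case: ifP => [ab|/negbT]; last rewrite -leNgt => ba.
    apply/andP/andP => [[/andP[? ?] /andP[? ?]]|[/andP[? ?] ?]].
      by split; [apply/andP; split|]; lra.
    by split; apply/andP; split; lra.
  apply/andP/andP => [[/andP[? ?] /andP[? ?]]|[/andP[? ?] ?]].
    by split; [apply/andP; split|]; lra.
  by split; apply/andP; split; lra.
rewrite /tri (_ : _ - `|_| = d - c).
  apply: has_mean_stripes => //; first by rewrite le_max a0.
  by rewrite /d; have := ge_min a a (b - w); rewrite lexx/=; lra.
rewrite /d /c; case: (leP a (b - w)) => ab.
  by rewrite ler0_norm; lra.
by rewrite ger0_norm; lra.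
Qed.

(** Expanding [profile] gives eight products of bumps, each with mean [tri] at its own offset; the
    offsets 2/4 and -2/4 occur twice. *)
Definition layer_mean w : R :=
  2 * tri (w + 2 / 4) - tri (w + 1 / 4) - tri (w + 3 / 4)
  - 2 * tri (w - 2 / 4) + tri (w - 1 / 4) + tri (w - 3 / 4).

Lemma has_mean_layer (s t x : R) : 0 < s ->
  has_mean (fun alpha => layer s alpha t x) (2 / s * layer_mean ((x - t) / s)).
Proof.
move=> s0; rewrite /layer; set w := (x - t) / s; apply: has_meanZ.
pose B (a b alpha : R) := bump a (frac ((t - alpha) / s)) *
                         bump b (frac ((t - alpha) / s) + w).
have BM a b : 0 <= a <= 3 / 4 -> has_mean (B a b) (tri (w + (a - b))).
  by move=> /andP[? ?]; exact: has_mean_bump.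
have H (k1 k2 : R) f g l m : has_mean f l -> has_mean g m ->
  has_mean (fun alpha => k1 * f alpha + k2 * g alpha) (k1 * l + k2 * m).
  by move=> F G; apply: has_meanD; exact: has_meanZ.
have b0 : 0 <= (0 : R) <= 3 / 4 by lra.
have b1 : 0 <= (1 / 4 : R) <= 3 / 4 by lra.
have b2 : 0 <= (2 / 4 : R) <= 3 / 4 by lra.
have b3 : 0 <= (3 / 4 : R) <= 3 / 4 by lra.
have H1 := H (-1) 1 _ _ _ _ (BM (1 / 4) (3 / 4) b1) (BM (1 / 4) (2 / 4) b1).
have H2 := H (1) (-1) _ _ _ _ (BM 0 (3 / 4) b0) (BM 0 (2 / 4) b0).
have H3 := H (1) (-1) _ _ _ _ (BM (3 / 4) (1 / 4) b3) (BM (3 / 4) 0 b3).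
have H4 := H (-1) (1) _ _ _ _ (BM (2 / 4) (1 / 4) b2) (BM (2 / 4) 0 b2).
have H5 := has_meanD (has_meanD H1 H2) (has_meanD H3 H4).
have E (f g : R -> R) l m : f =1 g -> l = m -> has_mean f l -> has_mean g m.
  by move=> /funext-> ->.
apply: (E _ _ _ _ _ _ H5) => [alpha|]; first by rewrite /profile /B/=; ring.
rewrite /layer_mean.
rewrite (_ : 1 / 4 - 3 / 4 = - (2 / 4) :> R); last by field.
rewrite (_ : 1 / 4 - 2 / 4 = - (1 / 4) :> R); last by field.
rewrite (_ : 3 / 4 - 1 / 4 = 2 / 4 :> R); last by field.
rewrite (_ : 2 / 4 - 1 / 4 = 1 / 4 :> R); last by field.
rewrite !sub0r !subr0; ring.
Qed.

End mean.

(** * Means of uniform limits *)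

Section limit.
Context {R : realType}.
Implicit Types a s r t x y z w alpha : R.
Local Notation mu := (@lebesgue_measure R).

Lemma dist_Rintegral (f g : R -> R) (D : set R) (e : R) :
  measurable D -> (mu D < +oo)%E ->
  mu.-integrable D (EFin \o f) -> mu.-integrable D (EFin \o g) ->
  (forall y, D y -> `|f y - g y| <= e) ->
  `|\int[mu]_(y in D) f y - \int[mu]_(y in D) g y| <= e * fine (mu D).
Proof.
move=> mD Dfin fi gi fg; rewrite -RintegralB//.
have fgi : mu.-integrable D (EFin \o (f \- g)).
  by apply: (eq_integrable _ _ _ _ (integrableB _ fi gi)).
rewrite (le_trans (le_normr_Rintegral _ fgi))// -Rintegral_cst//.
apply: le_Rintegral => //.
  exact: (integrable_norm fgi).
apply: measurable_bounded_integrable => //.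
by exists `|e|; split; [exact: num_real|move=> M eM y _; exact: ltW].
Qed.

(** The means of [f] and [g N] differ by at most [eps N] for every [T > 0]; this uniformity in [T]
    allows the limits in [N] and [T] to be exchanged. *)
Lemma has_mean_uniform_limit (f : R -> R) (g : nat -> R -> R) (A eps : nat -> R) :
  (forall N, has_mean (g N) (A N)) ->
  (forall N alpha, `|f alpha - g N alpha| <= eps N) -> eps @ \oo --> 0 ->
  exists2 l, has_mean f l & forall N, `|l - A N| <= eps N.
Proof.
move=> gA fg eps0.
have mf : measurable_fun setT f.
  apply: (measurable_fun_cvg (h := g)) => [N|alpha _]; first by case: (gA N).
  apply/cvgrPdist_le => e e0; move/cvgrPdist_le: eps0 => /(_ _ e0).
  apply: filterS => N; rewrite sub0r normrN => /(le_trans (ler_norm _)).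
  exact: le_trans.
have [M fM] : exists M, forall alpha, `|f alpha| <= M.
  have [_ [M gM] _] := gA 0%N; exists (eps 0%N + M) => alpha.
  by rewrite -[f alpha](subrK (g 0%N alpha)) (le_trans (ler_normD _ _))// lerD.
have dist N T : 0 < T -> `|mean f T - mean (g N) T| <= eps N.
  move=> T0; have [mg [K gK] _] := gA N; rewrite /mean -mulrBr normrM.
  have T2 : 0 < 2 * T by rewrite mulr_gt0.
  rewrite gtr0_norm ?invr_gt0// ler_pdivrMl// mulrC.
  have muT : mu `[- T, T] = (2 * T)%:E.
    rewrite lebesgue_measure_itv/= lte_fin ifT; last by lra.
    by rewrite -EFinB; congr EFin; ring.
  have := @dist_Rintegral f (g N) `[- T, T] (eps N).
  rewrite muT/=; apply => //;
    [exact: ltry|exact: mean_integrable fM|exact: mean_integrable gK].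
(* Cauchy criterion: for one [N] with [eps N < e / 2], [A N] is within [e] of [mean f T] for all
   large [T]. *)
have mc : cvg (mean f T @[T --> +oo]).
  apply/cauchy_cvgP/cauchy_exP => e e0.
  have e2 : 0 < e / 2 by rewrite divr_gt0.
  move/cvgrPdist_lt: eps0 => /(_ _ e2) [N _ /(_ N (leqnn N))].
  rewrite /= sub0r normrN => /(le_lt_trans (ler_norm _)) eN.
  exists (A N); have [_ _ /cvgrPdist_lt/(_ _ e2) gm] := gA N.
  near=> T; rewrite /ball/= [e]splitr.
  have T0 : 0 < T by near: T; exact: nbhs_pinfty_gt.
  rewrite (_ : A N - mean f T =
    (A N - mean (g N) T) - (mean f T - mean (g N) T)); last by ring.
  rewrite (le_lt_trans (ler_normB _ _))// ltrD//.
    by near: T.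
  exact: le_lt_trans (dist _ _ T0) eN.
exists (lim (mean f T @[T --> +oo])); first by split; [|exists M|].
move=> N; have [_ _ gm] := gA N.
have d : `|mean f T - mean (g N) T| @[T --> +oo] -->
    `|lim (mean f T @[T --> +oo]) - A N|.
  by apply: cvg_norm; apply: cvgB.
rewrite -(cvg_lim _ d)//; apply: limr_le; first exact: cvgP d.
by near=> T; apply: dist; near: T; exact: nbhs_pinfty_gt.
Unshelve. all: end_near. Qed.

End limit.

(** * Averages over dilations *)

Section primitive.
Context {R : realType}.
Implicit Types a s r t x y z w alpha : R.
Local Notation mu := (@lebesgue_measure R).

Definition ramp (v : R) : R := Num.max 0 v.

(** A tent is a second difference of ramps, a form with an explicit primitive. *)
Lemma tri_ramp w : tri w = ramp (w + 4^-1) - 2 * ramp w + ramp (w - 4^-1).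
Proof.
by rewrite /tri /ramp; case: (ler0P w) => ?; repeat case: leP => ?; lra.
Qed.

Definition ramp2 (v : R) : R := ramp v ^+ 2 / 2.

(** The quadratic remainder also holds across the kink of [ramp] at 0, so [ramp2] is differentiable
    everywhere. *)
Lemma ramp2_taylor (v h : R) : `|ramp2 (v + h) - ramp2 v - h * ramp v| <= h ^+ 2 / 2.
Proof.
rewrite ler_norml; rewrite /ramp2 /ramp.
case: (leP 0 v) => ?; case: (leP 0 (v + h)) => ?; apply/andP; split; nra.
Qed.

Global Instance is_derive_ramp2 (v : R) : is_derive v 1 ramp2 (ramp v).
Proof.
have H : h^-1 *: ((ramp2 \o shift v) (h *: (1 : R)) - ramp2 v) @[h --> 0^'] --> ramp v.
  apply/cvgrPdist_le => e e0; near=> h.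
  have h0 : h != 0 by near: h; exact: nbhs_dnbhs_neq.
  have he : `|h| <= e by near: h; exact: dnbhs0_le.
  rewrite /= scaler1 /shift/= [h + v]addrC.
  rewrite /GRing.scale/= distrC.
  rewrite (_ : _ - ramp v = h^-1 * (ramp2 (v + h) - ramp2 v - h * ramp v)); last by field.
  rewrite normrM normfV ler_pdivrMl ?normr_gt0// (le_trans (ramp2_taylor _ _))//.
  have hh := ler_wpM2l (normr_ge0 h) he; have := mulr_ge0 (normr_ge0 h) (normr_ge0 h).
  by rewrite -[h ^+ 2]real_normK ?num_real// expr2; lra.
by split; [exact: cvgP H|exact: cvg_lim H].
Unshelve. all: end_near. Qed.

(** The primitive of [tri] that is 0 to the left of -1/4 and 1/16 to the right of 1/4. *)
Definition tri_prim w : R := ramp2 (w + 4^-1) - 2 * ramp2 w + ramp2 (w - 4^-1).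

Global Instance is_derive_tri_prim w : is_derive w 1 tri_prim (tri w).
Proof.
rewrite tri_ramp /tri_prim; apply: is_derive_eq.
by rewrite !scaler0 oppr0 addr0 !mulr1.
Qed.

Definition layer_prim w : R :=
  2 * tri_prim (w + 2 / 4) - tri_prim (w + 1 / 4) - tri_prim (w + 3 / 4)
  - 2 * tri_prim (w - 2 / 4) + tri_prim (w - 1 / 4) + tri_prim (w - 3 / 4).

Global Instance is_derive_layer_prim w : is_derive w 1 layer_prim (layer_mean w).
Proof.
rewrite /layer_mean /layer_prim; apply: is_derive_eq.
by rewrite !(subr0, addr0, mulr1).
Qed.

Lemma continuous_layer_mean : continuous (@layer_mean R).
Proof.
have ct : continuous (@tri R).
  move=> w; apply: (@continuous_max _ _ (cst 0) (fun w => 4^-1 - `|w|)).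
    exact: cvg_cst.
  by apply: cvgB; [exact: cvg_cst|exact: norm_continuous].
have cs k : continuous (fun w => tri (w + k)).
  move=> w; apply: (continuous_comp (f := fun w => w + k)); last exact: ct.
  by apply: cvgD; [exact: cvg_id|exact: cvg_cst].
have cz k l : continuous (fun w => l * tri (w + k)).
  by move=> w; apply: cvgM; [exact: cvg_cst|exact: cs].
move=> w; apply: cvgD; last exact: cs.
apply: cvgD; last exact: cs.
apply: cvgB; last exact: cz.
apply: cvgB; last exact: cs.
apply: cvgB; last exact: cs.
exact: cz.
Qed.

Lemma ramp2_ge0 v : 0 <= v -> ramp2 v = v ^+ 2 / 2.
Proof. by move=> v0; rewrite /ramp2 /ramp max_r. Qed.

Lemma ramp2_le0 v : v <= 0 -> ramp2 v = 0.
Proof. by move=> v0; rewrite /ramp2 /ramp max_l// expr0n mul0r. Qed.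

(** [tri_prim] equals 1/16 at the three positive offsets and 0 at the three negative ones, and the
    coefficients 2, -1, -1 sum to zero. *)
Lemma layer_prim0 : layer_prim 0 = 0.
Proof.
rewrite /layer_prim /tri_prim /ramp2 /ramp.
by repeat (case: leP => ?; try lra).
Qed.

(* For [w >= 1] this is the cancellation [\int_0^oo layer_mean = 0]. *)
Lemma layer_prim_out w : 1 <= `|w| -> layer_prim w = 0.
Proof.
rewrite ler_normr => /orP[w1|w1]; rewrite /layer_prim /tri_prim.
  by rewrite !ramp2_ge0; [field|lra..].
by rewrite !ramp2_le0; [ring|lra..].
Qed.

End primitive.

(** * Telescoping of the layers under the measure dr/r *)

Section average.
Context {R : realType}.
Implicit Types r t u x alpha : R.
Local Notation mu := (@lebesgue_measure R).

Lemma exp2_gt0 (j : int) : 0 < 2 ^ j :> R.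
Proof. by rewrite exprz_gt0. Qed.

Lemma exp2D (j : int) (N : nat) : 2 ^ (j + N%:Z) = 2 ^ j * 2 ^+ N :> R.
Proof. by rewrite expfzDr. Qed.

Lemma cvg_half_pow (k : R) (j : int) : k / 2 ^ (j + N%:Z) @[N --> \oo] --> 0.
Proof.
have h1 : `|2^-1 : R| < 1 by rewrite ger0_norm; lra.
rewrite (_ : (fun N => _) = geometric (k / 2 ^ j) 2^-1); first exact: cvg_geometric.
by apply/funext => N; rewrite /geometric/= exp2D invfM exprVn mulrA.
Qed.

(** For [u = x - t], the translation mean of the layers [j0] to [j0 + N - 1], by
    [has_mean_layer]. *)
Definition partial_mean (j0 : int) (N : nat) u r : R :=
  \sum_(n < N) 2 / (r * 2 ^ (j0 + n%:Z)) * layer_mean (u / (r * 2 ^ (j0 + n%:Z))).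

Definition partial_prim (j0 : int) (N : nat) u r : R :=
  \sum_(n < N) layer_prim (u / (r * 2 ^ (j0 + n%:Z))).

(** Differentiating [u / (r * c)] in [r] produces an extra factor [1 / r], so the weight [dr/r]
    turns the mean of a layer into an exact derivative. *)
Lemma is_derive_layer_scale (c u r : R) : 0 < c -> 0 < r ->
  is_derive r 1 (fun r => layer_prim (u / (r * c)))
   (- (u / 2 * (2 / (r * c) * layer_mean (u / (r * c)) / r))).
Proof.
move=> c0 r0.
have rc : r * c != 0 by rewrite mulf_neq0// gt_eqF.
have dV : is_derive r 1 (fun r => u / (r * c)) (- (u / (r * c) / r)).
  rewrite (_ : (fun r => _) = fun r => u / c * r^-1); last first.
    by apply/funext => z; rewrite invfM [z^-1 * _]mulrC mulrA.
  have := @is_deriveV _ id r 1 1 (lt0r_neq0 r0) (is_derive_id _ _).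
  move=> /(is_deriveZ (u / c)) H; apply: is_derive_eq.
  rewrite /GRing.scale/=; field; rewrite !gt_eqF//.
apply: (is_derive_eq (is_derive1_comp (is_derive_layer_prim _) dV)).
by field; rewrite !gt_eqF.
Qed.

Lemma is_derive_partial_prim (j0 : int) N u r : 0 < r ->
  is_derive r 1 (partial_prim j0 N u) (- (u / 2 * (partial_mean j0 N u r / r))).
Proof.
move=> r0; elim: N => [|N IH].
  rewrite /partial_mean big_ord0 mul0r mulr0 oppr0.
  rewrite (_ : partial_prim _ _ _ = cst 0); first exact: is_derive_cst.
  by apply/funext => z; rewrite /partial_prim big_ord0.
rewrite (_ : partial_prim _ _ _ = partial_prim j0 N u \+
  fun r => layer_prim (u / (r * 2 ^ (j0 + N%:Z)))); last first.
  by apply/funext => z; rewrite /partial_prim big_ord_recr.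
rewrite /partial_mean big_ord_recr/= mulrDl mulrDr opprD.
apply: is_deriveD; apply: is_derive_layer_scale => //; exact: exp2_gt0.
Qed.

Lemma partial_mean_continuous (j0 : int) N u :
  {within `[1, 2], continuous (fun r => partial_mean j0 N u r / r)}.
Proof.
apply: continuous_in_subspaceT => r; rewrite inE/= in_itv/= => /andP[r1 _].
have r0 : r != 0 by rewrite gt_eqF// (lt_le_trans _ r1).
have cV c : c != 0 -> {for r, continuous (fun r => (r * c)^-1)}.
  move=> c0; apply: cvgV; first by rewrite mulf_neq0.
  by apply: cvgMl; exact: cvg_id.
apply: cvgM; last by apply: cvgV => //; exact: cvg_id.
elim: N => [|N IH]; rewrite /partial_mean.
  by under eq_fun do rewrite big_ord0; rewrite big_ord0; exact: cvg_cst.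
under eq_fun do rewrite big_ord_recr/=; rewrite big_ord_recr/=.
have c0 : 2 ^ (j0 + N%:Z) != 0 :> R by rewrite gt_eqF ?exp2_gt0.
apply: cvgD; first exact: IH.
apply: cvgM; first by apply: cvgMr; exact: cV.
apply: (continuous_comp (f := fun r => u / (r * 2 ^ (j0 + N%:Z)))).
  by apply: cvgMr; exact: cV.
exact: continuous_layer_mean.
Qed.

Lemma partial_mean_integrable (j0 : int) N u :
  mu.-integrable `[1, 2[ (EFin \o (fun r => partial_mean j0 N u r / r)).
Proof.
apply: (@integrableS _ _ _ mu `[1, 2]%classic) => //.
  by apply: subset_itvl; rewrite bnd_simp.
apply: continuous_compact_integrable; first exact: segment_compact.
exact: partial_mean_continuous.
Qed.

(* The layers telescope: doubling [r] shifts the scale by one. *)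
Lemma partial_mean_integral (j0 : int) N u : 2 ^ j0 <= `|u| ->
  u / 2 * (\int[mu]_(r in `[1, 2[) (partial_mean j0 N u r / r)) =
  - layer_prim (u / 2 ^ (j0 + N%:Z)).
Proof.
move=> ju.
(* The fundamental theorem of calculus is applied on the closed interval; the added endpoint has
   measure zero. *)
have -> : \int[mu]_(r in `[1, 2[) (partial_mean j0 N u r / r)
  = \int[mu]_(r in `[1, 2]) (partial_mean j0 N u r / r).
  by apply: Rintegral_itv_bndo_bndc; exact: partial_mean_integrable.
have ci := continuous_compact_integrable (@segment_compact R 1 2)
  (@partial_mean_continuous j0 N u).
rewrite -RintegralZl//.
pose F r := - partial_prim j0 N u r.
have dF r : 0 < r -> is_derive r 1 F (u / 2 * (partial_mean j0 N u r / r)).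
  move=> r0; rewrite -[X in is_derive _ _ _ X]opprK; apply: is_deriveN.
  exact: is_derive_partial_prim.
have cF r : 0 < r -> {for r, continuous F}.
  by move=> /dF[dr _]; apply/differentiable_continuous; rewrite -derivable1_diffP.
rewrite /Rintegral (@continuous_FTC2 _ _ F); first last.
- move=> r; rewrite in_itv/= => /andP[r1 _]; rewrite derive1E.
  by have [_ ->] := dF r (lt_trans ltr01 r1).
- split.
  + by move=> r; rewrite in_itv/= => /andP[r1 _]; have [] := dF r (lt_trans ltr01 r1).
  + by apply: cvg_at_right_filter; exact: cF.
  + by apply: cvg_at_left_filter; exact: cF.
- move=> r; apply: cvgM; [exact: cvg_cst|exact: partial_mean_continuous].
- by rewrite ltr1n.
rewrite /= /F opprK addrC /partial_prim -sumrB.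
rewrite -(big_mkord xpredT (fun n => layer_prim (u / (1 * 2 ^ (j0 + n%:Z)))
  - layer_prim (u / (2 * 2 ^ (j0 + n%:Z))))).
rewrite (@telescope_sumr_eq R 0 N
  (fun n : nat => - layer_prim (u / 2 ^ (j0 + n%:Z))))//; last first.
  by move=> n _; rewrite mul1r opprK [RHS]addrC !exp2D exprS mulrCA.
(* The other end of the telescope is [layer_prim (u / 2^j0)], which vanishes since [|u| >= 2^j0]. *)
rewrite [X in _ - - X]layer_prim_out ?oppr0 ?addr0// normrM normfV.
by rewrite [`|2 ^ _|]gtr0_norm ?exp2_gt0// ler_pdivlMr ?mul1r ?exp2_gt0.
Qed.

End average.

(** * Passage from the partial sums to the kernel *)

Section kernel.
Context {R : realType}.
Implicit Types r t u x alpha : R.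
Local Notation mu := (@lebesgue_measure R).

Lemma continuous_layer_prim : continuous (@layer_prim R).
Proof.
move=> w; apply/differentiable_continuous; rewrite -derivable1_diffP.
by have [] := is_derive_layer_prim w.
Qed.

(** As [r < 2], the layers below [j0] have length at most [2^j0], so one [j0] serves for all [r]. *)
Lemma shift_kernel_has_mean (j0 : int) r t x : 1 <= r < 2 ->
  x = t \/ 2 ^ j0 <= `|x - t| ->
  exists2 l, has_mean (fun alpha => shift_kernel alpha r t x) l &
    forall N, `|l - partial_mean j0 N (x - t) r| <= 4 / 2 ^ (j0 + N%:Z).
Proof.
move=> /andP[r1 r2] small; have r0 : 0 < r by rewrite (lt_le_trans _ r1).
apply: (has_mean_uniform_limit (g := fun N alpha =>
  \sum_(n < N) layer (r * 2 ^ (j0 + n%:Z)) alpha t x)); last exact: cvg_half_pow.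
  move=> N; apply: has_mean_sum => n; apply: has_mean_layer.
  by rewrite mulr_gt0// exp2_gt0.
move=> N alpha; apply: shift_kernel_approx => //.
case: small => [|small]; [by left|right]; apply: le_trans small.
rewrite (_ : 2 ^ j0 = 2 * 2 ^ (j0 - 1)); first by rewrite ler_pM2r ?exp2_gt0// ltW.
by rewrite -[2 in RHS]expr1z -expfzDr// addrC subrK.
Qed.

Lemma shift_kernel_diag alpha r t : 0 < r -> shift_kernel alpha r t t = 0.
Proof.
move=> r0; have [[]//|[i -> _]] := shift_kernel_layer alpha t t r0.
by apply: layer_eq0; [rewrite mulr_gt0 ?exp2_gt0|left].
Qed.

Lemma translation_averageE r t x l :
  has_mean (fun alpha => shift_kernel alpha r t x) l -> translation_average r t x = l.
Proof. by case=> _ _ ml; exact: cvg_lim ml. Qed.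

(** The bound survives division by [r >= 1] and is uniform in [r], which allows the limit in [N] to
    pass through the [dr/r] integral. *)
Lemma translation_average_approx (j0 : int) N r t x : 1 <= r < 2 ->
  x = t \/ 2 ^ j0 <= `|x - t| ->
  `|translation_average r t x / r - partial_mean j0 N (x - t) r / r|
    <= 4 / 2 ^ (j0 + N%:Z).
Proof.
move=> r12 small; have [l lm lN] := shift_kernel_has_mean r12 small.
have /andP[r1 _] := r12.
rewrite (translation_averageE lm) -mulrBl normrM (le_trans _ (lN N))// ler_piMr//.
by rewrite normfV ger0_norm ?invf_le1// ?(le_trans _ r1)// (lt_le_trans _ r1).
Qed.

(** Measurability in [r] comes from the pointwise limit of the integrands with [partial_mean], and
    boundedness from the approximation by the empty sum, [N = 0]. *)
Lemma translation_average_integrable t x :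
  mu.-integrable `[1, 2[ (fun r => (translation_average r t x / r)%:E).
Proof.
have [j0 small] := ex_exp2_le t x.
have near N r := @translation_average_approx j0 N r t x.
apply: (@bounded_itv_integrable _ _ _ (4 / 2 ^ (j0 + 0%N))).
- by rewrite lebesgue_measure_itv/=; case: ifP => _; rewrite ?ltry// -EFinB ltry.
- apply: (measurable_fun_cvg (h := fun N r => partial_mean j0 N (x - t) r / r)).
    move=> N.
    by have /integrableP[/measurable_EFinP] := @partial_mean_integrable R j0 N (x - t).
  move=> r; rewrite /= in_itv/= => r12.
  apply/cvgrPdist_le => e e0; have /cvgrPdist_le/(_ _ e0) := @cvg_half_pow R 4 j0.
  apply: filterS => N; rewrite sub0r normrN => /(le_trans (ler_norm _)).
  by apply: le_trans; exact: near.
- move=> r; rewrite in_itv/= => r12; have := near 0%N r r12 small.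
  by rewrite /partial_mean big_ord0 mul0r subr0.
Qed.

(** Multiplied by [(x - t) / 2], the integral is, up to a vanishing error,
    [- layer_prim ((x - t) / 2^(j0 + N))], which tends to [- layer_prim 0 = 0]. *)
Lemma integral_translation_average_eq0 t x : x != t ->
  \int[mu]_(r in `[1, 2[) (translation_average r t x / r) = 0.
Proof.
move=> xt; have [j0 small] := ex_exp2_le t x; set J := Rintegral _ _ _.
have ju : 2 ^ j0 <= `|x - t| by case: small => // /eqP; rewrite (negPf xt).
have u0 : (x - t) / 2 != 0 by rewrite mulf_neq0 ?subr_eq0.
have dist N : `|(x - t) / 2 * J| <= `|(x - t) / 2| * (4 / 2 ^ (j0 + N%:Z))
    + `|layer_prim ((x - t) / 2 ^ (j0 + N%:Z))|.
  rewrite -[`|layer_prim _|]normrN -(partial_mean_integral N ju).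
  rewrite -[X in `|X| <= _](subrK ((x - t) / 2 *
    \int[mu]_(r in `[1, 2[) (partial_mean j0 N (x - t) r / r))).
  rewrite (le_trans (ler_normD _ _))// lerD2r -mulrBr normrM ler_wpM2l//.
  have mu1 : mu `[1, 2[ = 1%:E.
    rewrite lebesgue_measure_itv/= lte_fin ltr1n/=.
    by rewrite -EFinB; congr EFin; ring.
  have := @dist_Rintegral R (fun r => translation_average r t x / r)
    (fun r => partial_mean j0 N (x - t) r / r) `[1, 2[ (4 / 2 ^ (j0 + N%:Z)).
  rewrite mu1 mulr1; apply => //; first exact: ltry.
  - exact: translation_average_integrable.
  - exact: partial_mean_integrable.
  - by move=> r; rewrite /= in_itv/= => r12; exact: translation_average_approx.
have lim0 : `|(x - t) / 2| * (4 / 2 ^ (j0 + N%:Z))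
    + `|layer_prim ((x - t) / 2 ^ (j0 + N%:Z))| @[N --> \oo] --> (0 : R).
  rewrite -[X in _ --> X]addr0; apply: cvgD.
    rewrite -[X in _ --> X](mulr0 `|(x - t) / 2|); apply: cvgMr; exact: cvg_half_pow.
  rewrite -[X in _ --> X](normr0 R) -(@layer_prim0 R); apply: cvg_norm.
  by apply: continuous_cvg; [exact: continuous_layer_prim|exact: cvg_half_pow].
have : `|(x - t) / 2 * J| <= 0.
  rewrite -(cvg_lim _ lim0)//; apply: limr_ge; first exact: cvgP lim0.
  by near=> N; exact: dist.
by rewrite normr_le0 mulf_eq0 (negPf u0) => /eqP.
Unshelve. all: end_near. Qed.

End kernel.

(* The first four clauses say that the sum, the integrals and the limit
   entering [kernel_average] exist, so that none of them takes the default
   value given by the library to a divergent expression. *)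
Theorem lemma8p1 (R : realType) (t x : R) :
  [/\ forall alpha r : R, 1 <= r < 2 ->
        finite_set [set I | dilated_grid alpha r I /\
                            shift_kernel_term t x I != 0],
      forall r T : R, 1 <= r < 2 -> 0 < T ->
        (@lebesgue_measure R).-integrable `[- T, T]
          (fun alpha => (shift_kernel alpha r t x)%:E),
      forall r : R, 1 <= r < 2 ->
        cvg (translation_mean r t x T @[T --> +oo]),
      (@lebesgue_measure R).-integrable `[1, 2[
        (fun r => (translation_average r t x / r)%:E)
    & kernel_average t x = 0].
Proof.
have [j0 small] := ex_exp2_le t x.
split.
- by move=> alpha r /andP[r1 _]; apply: shift_kernel_term_finite; exact: lt_le_trans r1.
- move=> r T r12 _; have [l [mf [M fM] _] _] := shift_kernel_has_mean r12 small.
  exact: mean_integrable fM.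
- move=> r r12; have [l [_ _ ml] _] := shift_kernel_has_mean r12 small.
  exact: cvgP ml.
- exact: translation_average_integrable.
rewrite /kernel_average; have [->|xt] := eqVneq x t; last first.
  by rewrite integral_translation_average_eq0// mulr0.
(* On the diagonal the telescoping identity, multiplied by [x - t], gives no information; there the
   kernel itself vanishes, as no midpoint separates [t] from itself. *)
rewrite (_ : Rintegral _ _ _ = 0) ?mulr0//.
rewrite (@eq_Rintegral _ _ _ _ _ (fun=> 0)) ?Rintegral_cst ?mul0r// => r.
rewrite inE/= in_itv/= => /andP[r1 _]; rewrite (@translation_averageE _ _ _ _ 0) ?mul0r//.
rewrite (_ : (fun _ => _) = fun=> 0); first exact: has_mean0.
by apply/funext => alpha; rewrite shift_kernel_diag// (lt_le_trans _ r1).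
Qed.
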